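(* Let $A$ be a Noetherian $\mathbb{Z}^{n}$-graded domain such that $A_{\mathbf 0}$ is a field. Assume that $C(A)=(\mathbb{R}_{\ge0})^n$. Let $\mathbf e_i$ be the $i$-th unit vector in $\mathbb{R}^n$, and let $B$ be the subring of $A$ generated over $A_{\mathbf 0}$ by $$\bigcup_{i=1}^{n}\Big[\bigcup_{m>0}A_{m\mathbf e_i}\Big].$$ Then the following conditions are equivalent: (1) The inclusion $B\to A$ is a finite extension. (2) Any face of $(\mathbb{R}_{\ge0})^n$ is a ray ideal cone of $A$. (3) $C(A)$ itself is a ray ideal cone of $A$.
   Context: Rings are commutative with $1$. A $\mathbb{Z}^n$-graded ring is a ring $A=\bigoplus_{\mathbf a\in\mathbb{Z}^n}A_{\mathbf a}$ with additive subgroups $A_{\mathbf a}$ such that $A_{\mathbf a}A_{\mathbf b}\subset A_{\mathbf a+\mathbf b}$; a $\mathbb{Z}^n$-graded domain is one that is an integral domain. Put $C(A)=\sum_{A_{\mathbf a}\ne0}\mathbb{R}_{\ge0}\mathbf a\subset\mathbb{R}^n$. A cone in $\mathbb{R}^n$ is a subset $\sigma$ closed under addition and with $\mathbb{R}_{\ge0}\mathbf a\subset\sigma$ for all $\mathbf a\in\sigma$; ${\rm rel.int}(\sigma)$ is its relative interior (interior in $\sigma-\sigma$). For $\mathbf a\in\mathbb{Q}^n$, $I_{\mathbf a}(A)$ is the ideal of $A$ generated by $\bigcup_{\mathbf b\in\mathbb{R}_{>0}\mathbf a\cap\mathbb{Z}^n}A_{\mathbf b}$, and $J_{\mathbf a}(A)=\sqrt{I_{\mathbf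 a}(A)}$. A ray ideal cone of $A$ is a cone $\sigma$ such that $\sigma-\sigma$ is an $\mathbb{R}$-subspace spanned by finitely many elements of $\mathbb{Q}^n$ and $J_{\mathbf a}(A)=J_{\mathbf b}(A)\ne0$ for all $\mathbf a,\mathbf b\in{\rm rel.int}(\sigma)\cap\mathbb{Q}^n$. *)

(* Defs.v *)
From HB Require Import structures.
From mathcomp Require Import all_boot all_order all_algebra.
From mathcomp Require Import all_classical all_reals all_analysis.

Set Implicit Arguments.
Unset Strict Implicit.
Unset Printing Implicit Defensive.

Import Order.TTheory GRing.Theory Num.Theory.
Import numFieldNormedType.Exports.

Local Open Scope classical_set_scope.
Local Open Scope ring_scope.

Section Rings.
Variable A : comNzRingType.

Definition is_ideal (I : set A) : Prop :=
  [/\ I 0, forall x y, I x -> I y -> I (x + y) & forall r x, I x -> I (r * x)].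

Definition ideal_gen (S : set A) : set A := smallest is_ideal S.

Definition radical (I : set A) : set A := [set x | exists k, I (x ^+ k)].

Definition noetherian : Prop :=
  forall I, is_ideal I -> exists s : seq A, I = ideal_gen [set` s].

Definition is_subring (S : set A) : Prop := GRing.subring_closed [in S].

Definition subring_gen (S : set A) : set A := smallest is_subring S.

Definition is_subfield (S : set A) : Prop :=
  is_subring S /\
  forall x, S x -> x <> 0 -> exists2 y, S y & x * y = 1.

(* [B -> A] is a finite extension: [A] is a finitely generated [B]-module. *)
Definition finite_extension (B : set A) : Prop :=
  exists s : seq A, forall x : A, exists c : 'I_(size s) -> A,
    (forall i, B (c i)) /\ x = \sum_(i < size s) c i * s`_i.

End Rings.

Section Graded.
Variables (n : nat) (A : comNzRingType).

(* The finiteness of the support is required separately, since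
   [\sum_(a \in D) c a] is [0] when [c] has infinite support. *)
Definition is_grading (gr : 'rV[int]_n -> set A) : Prop :=
  [/\ forall a, GRing.zmod_closed [in gr a],
      forall x : A, exists! c : 'rV[int]_n -> A,
        [/\ forall a, gr a (c a),
            finite_set [set a | c a != 0] &
            x = \sum_(a \in [set: 'rV[int]_n]) c a] &
      forall a b x y, gr a x -> gr b y -> gr (a + b) (x * y)].

Definition axis_subring (gr : 'rV[int]_n -> set A) : set A :=
  subring_gen (gr 0 `|`
    \bigcup_(i in [set: 'I_n]) \bigcup_(m in [set m : int | 0 < m])
      gr (m *: delta_mx 0 i)).

End Graded.

Section Cones.
Variables (R : realType) (n : nat).
Implicit Types s t : set 'rV[R]_n.

Definition is_cone s : Prop :=
  (forall x y, s x -> s y -> s (x + y)) /\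
  (forall x (r : R), 0 <= r -> s x -> s (r *: x)).

Definition diffset s : set 'rV[R]_n :=
  [set z | exists x y, [/\ s x, s y & z = x - y]].

Definition relint s : set 'rV[R]_n :=
  [set x | s x /\ within (diffset s) (nbhs x) s].

Definition ratv (a : 'rV[rat]_n) : 'rV[R]_n := map_mx ratr a.

Definition intv (b : 'rV[int]_n) : 'rV[R]_n := map_mx intr b.

Definition rational_span s : Prop :=
  exists l : seq 'rV[rat]_n, s = [set` <<map ratv l>>%VS].

Definition orthant : set 'rV[R]_n := [set x | forall i, 0 <= x 0 i].

(* Faces are cut out by supporting linear forms; the zero form gives [s]
   itself, and a face of a cone containing [0] contains [0]. *)
Definition is_face s t : Prop :=
  exists u : {scalar 'rV[R]_n},
    (forall x, s x -> 0 <= u x) /\ t = [set x | s x /\ u x = 0].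

End Cones.

Arguments orthant R n : clear implicits.

Section RayIdeals.
Variables (R : realType) (n : nat) (A : comNzRingType).
Variable gr : 'rV[int]_n -> set A.

Definition degree_cone : set 'rV[R]_n :=
  [set x | exists l : seq (R * 'rV[int]_n),
     (forall p, p \in l -> 0 <= p.1 /\ gr p.2 <> [set 0]) /\
     x = \sum_(p <- l) p.1 *: intv R p.2].

Definition ray_ideal (a : 'rV[rat]_n) : set A :=
  ideal_gen (\bigcup_(b in [set b | exists2 r : R, 0 < r &
                                      intv R b = r *: ratv R a]) gr b).

Definition rad_ray_ideal (a : 'rV[rat]_n) : set A := radical (ray_ideal a).

(* The empty set satisfies [is_cone], but [rational_span] excludes it. *)
Definition is_ray_ideal_cone (s : set 'rV[R]_n) : Prop :=
  [/\ is_cone s,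
      rational_span (diffset s) &
      forall a b : 'rV[rat]_n, relint s (ratv R a) -> relint s (ratv R b) ->
        rad_ray_ideal a = rad_ray_ideal b /\ rad_ray_ideal b <> [set 0]].

End RayIdeals.

Arguments degree_cone R {n A} gr.

(* Main.v *)
(* For (1) => (2): write a high power of a homogeneous element f of A as a
   combination of module generators; its coefficients in B have degrees positive
   on the support of the face, and an element of B of degree d is a sum of products
   of elements of degrees d_i e_i. Powers of those axis elements can be balanced
   to reach any ray in the relative interior, which gives the inclusions of the
   radicals.

   For (3) => (1): let X_i be the ideal generated by the A_{m e_i}, m > 0. By
   noetherianity the degrees of generators are bounded, so A_c lies in X_i as
   soon as c is close enough to the axis of e_i; since J_a does not depend on a,
   every homogeneous element of positive degree in all coordinates is in the
   radical of X_i. If deg f is merely positive in its i-th coordinate, then f^k V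
   lies in X_i V for the ideal V of degrees that are large off the i-th
   coordinate, and the determinant trick puts f in the radical of X_i. Hence all
   high degrees lie in the ideal generated by the axis elements, and a graded
   Nakayama argument shows that A is generated over B by its low degrees. *)
Require Import Defs.
From mathcomp Require Import all_boot all_order all_algebra.
From mathcomp Require Import all_classical all_reals all_analysis.
From mathcomp Require Import zify ring lra.

Set Implicit Arguments.
Unset Strict Implicit.
Unset Printing Implicit Defensive.

Import Order.TTheory GRing.Theory Num.Theory.
Import numFieldNormedType.Exports.

Local Open Scope classical_set_scope.
Local Open Scope ring_scope.

(** * Ideals, radicals and the determinant trick *)

Section Ideals.
Variable A : comNzRingType.
Implicit Types (I S : set A) (s w : seq A).

Lemma ideal_sum I (J : Type) (r : seq J) (P : pred J) (F : J -> A) :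
  is_ideal I -> (forall j, P j -> I (F j)) -> I (\sum_(j <- r | P j) F j).
Proof. by case=> I0 ID _ IF; elim/big_ind: _ => //; exact: ID. Qed.

Lemma ideal_mulr I x r : is_ideal I -> I x -> I (x * r).
Proof. by case=> _ _ IM Ix; rewrite mulrC; exact: IM. Qed.

Lemma ideal_gen_ideal S : is_ideal (ideal_gen S).
Proof.
split=> [J [[]//]|x y Sx Sy J JS|r x Sx J JS]; case: (JS) => -[J0 JD JM] _.
  by apply: JD; [exact: Sx|exact: Sy].
by apply: JM; exact: Sx.
Qed.

Lemma sub_ideal_gen S : S `<=` ideal_gen S.
Proof. exact: sub_smallest. Qed.

Lemma ideal_gen_min I S : is_ideal I -> S `<=` I -> ideal_gen S `<=` I.
Proof. exact: smallest_sub. Qed.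

Lemma ideal_gen_ind S (P : A -> Prop) v : ideal_gen S v ->
  P 0 -> (forall x y, P x -> P y -> P (x + y)) ->
  (forall h x, S x -> P (h * x)) -> P v.
Proof.
move=> Sv P0 PD PM; rewrite -[v]mul1r.
(* [P] need not be stable under multiplication, so the statement is strengthened to all multiples
   [r * v], which do form an ideal. *)
suff /(_ v Sv 1) : ideal_gen S `<=` [set v | forall r, P (r * v)] by [].
apply: smallest_sub => [|x Sx r]; last exact: PM.
split=> [r|x y Px Py r|r x Px q] /=; first by rewrite mulr0.
- by rewrite mulrDr; exact: PD.
- by rewrite mulrA.
Qed.

Lemma ideal_gen_seqP s v :
  ideal_gen [set` s] v <->
  exists c : 'I_(size s) -> A, v = \sum_(i < size s) c i * s`_i.
Proof.
split; last first.
  move=> [c ->]; have gI := ideal_gen_ideal [set` s].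
  apply: ideal_sum => // i _; case: (gI) => _ _; apply.
  by apply: sub_ideal_gen => /=; rewrite mem_nth.
move=> sv; pattern v; apply: (ideal_gen_ind sv) => [|x y [c ->] [d ->]|h x /= sx].
- by exists (fun=> 0); rewrite big1 // => i _; rewrite mul0r.
- by exists (fun i => c i + d i); rewrite -big_split; apply: eq_bigr => i _; rewrite mulrDl.
- have ls : (index x s < size s)%N by rewrite index_mem.
  exists (fun i => if i == Ordinal ls then h else 0).
  rewrite (bigD1 (Ordinal ls)) //= eqxx nth_index // big1 ?addr0 // => i /negPf ->.
  by rewrite mul0r.
Qed.

(** Each of the finitely many generators supplied by noetherianity involves only finitely many
    elements of [S]; these are collected. Choosing generators inside [S] later makes them
    homogeneous. *)
Lemma noetherian_ideal_gen S : noetherian A ->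
  exists2 s : seq A, [set` s] `<=` S & ideal_gen S = ideal_gen [set` s].
Proof.
move=> noeth; have [t et] := noeth _ (ideal_gen_ideal S).
have fin v : ideal_gen S v -> exists2 s : seq A, [set` s] `<=` S & ideal_gen [set` s] v.
  move=> Sv; pattern v; apply: (ideal_gen_ind Sv) => [|x y [s sS sx] [s' s'S s'y]|h x Sx].
  - by exists [::] => //; case: (ideal_gen_ideal [set` [::] : seq A]).
  - exists (s ++ s') => [z /=|]; first by rewrite mem_cat => /orP[/sS|/s'S].
    case: (ideal_gen_ideal [set` s ++ s']) => _ D _; apply: D.
      by apply: ideal_gen_min sx => [|z /= zs]; [exact: ideal_gen_ideal|];
        apply: sub_ideal_gen; rewrite /= mem_cat zs.
    by apply: ideal_gen_min s'y => [|z /= zs]; [exact: ideal_gen_ideal|];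
      apply: sub_ideal_gen; rewrite /= mem_cat zs orbT.
  - exists [:: x] => [z /=|]; first by rewrite inE => /eqP ->.
    case: (ideal_gen_ideal [set` [:: x]]) => _ _; apply.
    by apply: sub_ideal_gen; rewrite /= inE.
have [s sS ts] : exists2 s : seq A, [set` s] `<=` S & [set` t] `<=` ideal_gen [set` s].
  have : [set` t] `<=` ideal_gen S by rewrite et; exact: sub_ideal_gen.
  elim: t {et} => [|x t IH] tS; first by exists [::].
  have [|s sS st] := IH; first by move=> z /= zt; apply: tS; rewrite /= inE zt orbT.
  have [|s' s'S s'x] := fin x; first by apply: tS; rewrite /= inE eqxx.
  exists (s ++ s') => [z /=|z /=]; first by rewrite mem_cat => /orP[/sS|/s'S].
  rewrite inE => /predU1P[->|/st].
    by apply: ideal_gen_min s'x => [|y /= ys]; [exact: ideal_gen_ideal|];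
      apply: sub_ideal_gen; rewrite /= mem_cat ys orbT.
  by apply: ideal_gen_min => [|y /= ys]; [exact: ideal_gen_ideal|];
    apply: sub_ideal_gen; rewrite /= mem_cat ys.
exists s => //; apply/seteqP; split.
  by rewrite et; apply: ideal_gen_min => //; exact: ideal_gen_ideal.
apply: ideal_gen_min; first exact: ideal_gen_ideal.
by move=> x /sS; exact: sub_ideal_gen.
Qed.

Lemma sub_radical I : I `<=` radical I.
Proof. by move=> x Ix; exists 1; rewrite expr1. Qed.

Lemma ideal_exprW I x (k l : nat) : is_ideal I -> (k <= l)%N ->
  I (x ^+ k) -> I (x ^+ l).
Proof.
by move=> II kl Ix; rewrite -(subnK kl) exprD; case: II => _ _; apply.
Qed.

Lemma radical_ideal I : is_ideal I -> is_ideal (radical I).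
Proof.
move=> II; case: (II) => I0 ID IM; split=> [|x y [k xk] [l yl]|r x [k xk]].
- exact: sub_radical.
(* In each binomial term of degree [k + l], either the exponent of [y] is at least [l] or that of
   [x] is at least [k]. *)
- exists (k + l)%N; rewrite exprDn; apply: ideal_sum => // i _.
  rewrite -mulr_natl; apply: (IM); have [li|il] := leqP l i.
    by apply: IM; exact: ideal_exprW yl.
  by apply: ideal_mulr => //; apply: ideal_exprW xk => //; lia.
- by exists k; rewrite exprMn; exact: IM.
Qed.

Lemma radical_idem I : radical (radical I) `<=` radical I.
Proof. by move=> x [k [l xkl]]; exists (k * l)%N; rewrite exprM. Qed.

(** Pigeonhole: among more than [size s * K] factors taken from [s], one occurs at least [K]
    times. *)
Lemma ideal_prod_count I s w (K : nat) : is_ideal I ->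
  (forall g, g \in s -> I (g ^+ K)) -> {subset w <= s} ->
  (size s * K < size w)%N -> I (\prod_(g <- w) g).
Proof.
move=> II; elim: s w => [|g s IH] w sK ws.
  by case: w ws => [|x w] // /(_ x (mem_head _ _)).
rewrite /= mulSn => ltw; rewrite (bigID (pred1 g)) /=.
have -> : \prod_(i <- w | i == g) i = g ^+ count_mem g w.
  rewrite (eq_bigr (fun=> g)); last by move=> i /eqP.
  by rewrite big_const_seq iter_mulr_1.
have [Kc|cK] := leqP K (count_mem g w).
  by apply: ideal_mulr => //; apply: ideal_exprW (sK g (mem_head _ _)).
case: (II) => _ _; apply; rewrite -big_filter; apply: IH => [h hs|h|].
- by apply: sK; rewrite inE hs orbT.
- by rewrite mem_filter => /andP[/negPf hg /ws]; rewrite inE hg.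
- rewrite size_filter; change (size s * K < count (predC (pred1 g)) w)%N.
  rewrite ltnNge; apply/negP => le; move: ltw.
  by rewrite ltnNge -(count_predC (pred1 g) w) leq_add // ltnW.
Qed.

(** The determinant is a polynomial in the entries, hence respects congruence modulo an ideal. *)
Lemma det_congr I m (M N : 'M[A]_m) : is_ideal I ->
  (forall i j, I (M i j - N i j)) -> I (\det M - \det N).
Proof.
move=> II MN; rewrite /determinant -sumrB; apply: ideal_sum => // s _.
rewrite -mulrBr; case: (II) => I0 ID IM; apply: (IM).
apply: (big_ind2 (fun x y => I (x - y))) => [|x x' y y' xx yy|i _] //.
  by rewrite subrr.
have -> : x * y - x' * y' = y * (x - x') + x' * (y - y') by ring.
by apply: ID; apply: IM.
Qed.

End Ideals.

(** The matrix [M], equal to [F] times the identity minus the coefficients, kills the vector [s].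
    Its adjugate gives [\det M * g = 0], so [\det M = 0] in a domain, while modulo [I] this
    determinant is [F ^+ size s]. *)
Lemma det_trick (A : idomainType) (I : set A) (s : seq A) (F : A) :
  is_ideal I -> (exists2 g, g \in s & g != 0) ->
  (forall g, g \in s -> exists c : 'I_(size s) -> A,
     (forall j, I (c j)) /\ F * g = \sum_(j < size s) c j * s`_j) ->
  radical I F.
Proof.
move=> II [g gs g0] sF.
have /choice[C HC] : forall i : 'I_(size s), exists c : 'I_(size s) -> A,
    (forall j, I (c j)) /\ F * s`_i = \sum_(j < size s) c j * s`_j.
  by move=> i; apply: sF; rewrite mem_nth.
pose M : 'M[A]_(size s) := F%:M - \matrix_(i, j) C i j.
pose v : 'cV[A]_(size s) := \col_j s`_j.
have Mv : M *m v = 0.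
  apply/matrixP => i j; rewrite mulmxBl mul_scalar_mx !mxE.
  rewrite (HC i).2; apply/eqP; rewrite subr_eq0; apply/eqP.
  by apply: eq_bigr => k _; rewrite !mxE.
have ls : (index g s < size s)%N by rewrite index_mem.
have detM : \det M = 0.
  have : \adj M *m (M *m v) = 0 by rewrite Mv mulmx0.
  rewrite mulmxA mul_adj_mx mul_scalar_mx => /matrixP/(_ (Ordinal ls) 0).
  rewrite !mxE /= nth_index // => /eqP; rewrite mulf_eq0 (negPf g0) orbF.
  by move/eqP.
exists (size s); rewrite -det_scalar.
rewrite -[\det _]subr0 -detM; apply: det_congr => // i j.
by rewrite /M !mxE opprB addrC subrK; exact: (HC i).1.
Qed.

(** * Homogeneous components *)

Section Grading.
Variables (n : nat) (A : comNzRingType) (gr : 'rV[int]_n -> set A).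
Hypothesis hgr : is_grading gr.
Implicit Types (a b d : 'rV[int]_n) (x y z : A) (S : set A).

Lemma gr0 a : gr a 0.
Proof. by case: hgr => /(_ a)[]; rewrite inE. Qed.

Lemma grB a x y : gr a x -> gr a y -> gr a (x - y).
Proof.
case: hgr => /(_ a)[_ B] _ _ ax ay.
by have := B x y; rewrite !in_setE; apply.
Qed.

Lemma grN a x : gr a x -> gr a (- x).
Proof. by move=> ax; rewrite -sub0r; apply: grB => //; exact: gr0. Qed.

Lemma grD a x y : gr a x -> gr a y -> gr a (x + y).
Proof. by move=> ax ay; rewrite -[y]opprK; apply: grB => //; exact: grN. Qed.

Lemma grM a b x y : gr a x -> gr b y -> gr (a + b) (x * y).
Proof. by case: hgr => _ _; apply. Qed.

Lemma homogeneous_components_exist x : exists c : 'rV[int]_n -> A,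
  unique (fun c => [/\ forall a, gr a (c a), finite_set [set a | c a != 0] &
                       x = \sum_(a \in [set: 'rV[int]_n]) c a]) c.
Proof. by case: hgr => _ /(_ x). Qed.

Definition hcomp a x : A := sval (cid (homogeneous_components_exist x)) a.

Lemma hcompP x : [/\ forall a, gr a (hcomp a x),
  finite_set [set a | hcomp a x != 0] & x = \sum_(a \in setT) hcomp a x].
Proof. by rewrite /hcomp; case: cid => c /= []. Qed.

Lemma hcomp_unique (c : 'rV[int]_n -> A) x : (forall a, gr a (c a)) ->
  finite_set [set a | c a != 0] -> x = \sum_(a \in setT) c a ->
  forall a, hcomp a x = c a.
Proof. by move=> h1 h2 h3 a; rewrite /hcomp; case: cid => e /= [_ /(_ c)->]. Qed.

Lemma gr_hcomp a x : gr a (hcomp a x).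
Proof. by case: (hcompP x). Qed.

Lemma homogeneous_ind (P : A -> Prop) : P 0 ->
  (forall x y, P x -> P y -> P (x + y)) -> (forall a x, gr a x -> P x) ->
  forall x, P x.
Proof.
move=> P0 PD Ph x; have [h1 h2 ->] := hcompP x.
by apply: (big_ind P) => // a _; exact: Ph (h1 a).
Qed.

Lemma hcomp_hom a b x : gr a x -> hcomp b x = if b == a then x else 0.
Proof.
move=> ax; apply: (@hcomp_unique (fun b => if b == a then x else 0)).
- by move=> d; case: eqP => [->//|_]; exact: gr0.
- by apply: (sub_finite_set (B := [set a])) => [d /=|]; [case: (d =P a) => //; rewrite eqxx|].
- rewrite -(@fsbig_widen _ _ _ _ [set a]) // => [|d [_ /= /eqP/negPf ->//]].
  by rewrite fsbig_set1 eqxx.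
Qed.

Lemma hcompD a x y : hcomp a (x + y) = hcomp a x + hcomp a y.
Proof.
have [hx fx ex] := hcompP x; have [hy fy ey] := hcompP y.
(* A common finite support over which all three sums can be taken. *)
pose E := [set a | hcomp a x != 0] `|` [set a | hcomp a y != 0].
have finE : finite_set E by rewrite finite_setU.
have subE : [set d | hcomp d x + hcomp d y != 0] `<=` E.
  move=> d /=; have [->|] := eqVneq (hcomp d x) 0; last by left.
  by rewrite add0r; right.
apply: (@hcomp_unique (fun a => hcomp a x + hcomp a y)).
- by move=> d; exact: grD.
- by apply: (sub_finite_set _ finE).
- have widen (f : 'rV[int]_n -> A) : (forall d, ~ E d -> f d = 0) ->
      \sum_(d \in E) f d = \sum_(d \in setT) f d.
    by move=> f0; apply: fsbig_widen => // d [_ /f0].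
  rewrite -widen ?fsbig_split //=; last by move=> d nE; apply: contra_notP nE => /eqP; exact: subE.
  by rewrite !widen -?ex -?ey // => d; apply: contra_notP => /eqP ?; [right|left].
Qed.

Lemma hcomp0 a : hcomp a 0 = 0.
Proof. by rewrite (hcomp_hom _ (gr0 a)); case: ifP. Qed.

Lemma hcompN a x : hcomp a (- x) = - hcomp a x.
Proof. by apply/eqP; rewrite -addr_eq0 -hcompD addNr hcomp0. Qed.

Lemma hcomp_sum a (J : Type) (r : seq J) (P : pred J) (F : J -> A) :
  hcomp a (\sum_(j <- r | P j) F j) = \sum_(j <- r | P j) hcomp a (F j).
Proof. by apply: (big_morph (hcomp a)) => [x y|]; [exact: hcompD|exact: hcomp0]. Qed.

Lemma hcomp_self a x : gr a x -> hcomp a x = x.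
Proof. by move/(hcomp_hom a) => ->; rewrite eqxx. Qed.

Lemma gr_unique a b x : gr a x -> gr b x -> x != 0 -> a = b.
Proof.
move=> /(hcomp_hom b) e /hcomp_self; rewrite e.
by case: (b =P a) => [->//|_ <-]; rewrite eqxx.
Qed.

Lemma hcompM c d x y : gr d x -> hcomp c (x * y) = x * hcomp (c - d) y.
Proof.
move=> dx; elim/homogeneous_ind: y => [|y z Hy Hz|a y ay].
- by rewrite mulr0 !hcomp0 mulr0.
- by rewrite mulrDr !hcompD Hy Hz mulrDr.
rewrite (hcomp_hom _ ay) (hcomp_hom _ (grM dx ay)) subr_eq (addrC d).
by case: ifP; rewrite ?mulr0.
Qed.

(** Taking the component of degree [c] of a combination of homogeneous generators keeps only the
    part of degree [c - d] of each coefficient. A homogeneous member is thus a combination with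
    homogeneous coefficients. *)
Lemma homogeneous_ideal_ind S c (P : A -> Prop) v :
  (forall s, S s -> exists d, gr d s) -> ideal_gen S v -> gr c v ->
  P 0 -> (forall x y, P x -> P y -> P (x + y)) ->
  (forall s d h, S s -> gr d s -> gr (c - d) h -> P (h * s)) -> P v.
Proof.
move=> Sh Sv cv P0 PD PM; rewrite -(hcomp_self cv).
have : (fun v => P (hcomp c v)) v.
  apply: (ideal_gen_ind (P := fun v => P (hcomp c v)) Sv) => [|x y|h s Ss].
  - by rewrite hcomp0.
  - by rewrite hcompD; exact: PD.
  - have [d ds] := Sh _ Ss; rewrite mulrC (hcompM _ _ ds) mulrC.
    exact: PM (gr_hcomp _ _).
by [].
Qed.

Hypothesis gr1 : gr 0 1.

Lemma grX a x (k : nat) : gr a x -> gr (a *+ k) (x ^+ k).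
Proof.
move=> ax; elim: k => [|k IH]; first by rewrite expr0 mulr0n.
by rewrite exprS mulrS; exact: grM.
Qed.

Lemma gr_prod (J : Type) (r : seq J) (P : pred J) (d : J -> 'rV[int]_n) (F : J -> A) :
  (forall j, P j -> gr (d j) (F j)) ->
  gr (\sum_(j <- r | P j) d j) (\prod_(j <- r | P j) F j).
Proof. by move=> dF; apply: (big_ind2 gr) => // a x b y; exact: grM. Qed.

End Grading.

(** * Radicals of the ideals of axis elements *)

Section HomogeneousGenerators.
Variables (n : nat) (A : comNzRingType) (gr : 'rV[int]_n -> set A).
Hypothesis hgr : is_grading gr.
Hypothesis noeth : noetherian A.
Implicit Types (a b d : 'rV[int]_n) (x y : A) (s w : seq A).

(** The generators are kept nonzero so that each has a single degree. *)
Lemma homogeneous_generators (T : set 'rV[int]_n) : exists s : seq A,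
  (forall g, g \in s -> g != 0 /\ exists2 d, T d & gr d g) /\
  (forall a x, T a -> gr a x -> ideal_gen [set` s] x).
Proof.
have [s sT es] := noetherian_ideal_gen
  [set x | x != 0 /\ exists2 d, T d & gr d x] noeth.
exists s; split=> [g /sT //|a x Ta ax]; rewrite -es.
have [->|x0] := eqVneq x 0.
  by case: (ideal_gen_ideal [set x | x != 0 /\ exists2 d, T d & gr d x]).
by apply: sub_ideal_gen; split=> //; exists a.
Qed.

Lemma degree_bound s (mu : 'rV[int]_n -> int) :
  (forall g, g \in s -> g != 0 /\ exists d, gr d g) ->
  exists2 N : nat, (0 < N)%N & forall g d, g \in s -> gr d g -> mu d <= N%:Z.
Proof.
elim: s => [|g s IH] hs; first by exists 1%N.
have [|N N0 HN] := IH; first by move=> h sh; apply: hs; rewrite inE sh orbT.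
have [g0 [e eg]] := hs g (mem_head _ _).
exists (N + `|mu e|)%N => [|h d]; first by rewrite addn_gt0 N0.
rewrite inE => /predU1P[-> dg|/HN /[apply] ?]; last by lia.
by rewrite (gr_unique hgr dg eg g0); lia.
Qed.

Lemma radical_common_exponent (X : set A) s : is_ideal X ->
  (forall g, g \in s -> radical X g) ->
  exists K : nat, forall g, g \in s -> X (g ^+ K).
Proof.
move=> XI; elim: s => [|g s IH] hs; first by exists 0%N.
have [|K HK] := IH; first by move=> h sh; apply: hs; rewrite inE sh orbT.
have [L HL] := hs g (mem_head _ _).
exists (K + L)%N => h; rewrite inE => /predU1P[->|/HK].
  by apply: ideal_exprW HL => //; rewrite leq_addl.
by apply: ideal_exprW => //; rewrite leq_addr.
Qed.

(* The ideal spanned by the degrees with all [lam j >= D] lies, for large [D],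
   in a given power of the one with all [lam j >= 1], because the generators
   of the latter have bounded degrees. *)
Lemma radical_high_degrees (J : finType) (lam : J -> 'rV[int]_n -> int)
    (X : set A) f :
  (forall j a b, lam j (a - b) = lam j a - lam j b) -> is_ideal X ->
  (forall a x, (forall j, 1 <= lam j a) -> gr a x -> radical X (f * x)) ->
  exists k D : nat,
    forall a x, (forall j, D%:Z <= lam j a) -> gr a x -> X (f ^+ k * x).
Proof.
move=> lamB XI Xf.
have [s [s1 s2]] := homogeneous_generators [set a | forall j, 1 <= lam j a].
have [|N N0 HN] := @degree_bound s (fun d => \sum_j `|lam j d|).
  by move=> g /s1[g0 [d _ dg]]; split=> //; exists d.
have lamN g d j : g \in s -> gr d g -> lam j d <= N%:Z.
  move=> sg /(HN _ _ sg); apply: le_trans.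
  rewrite (bigD1 j) //= (le_trans (ler_norm _)) // lerDl.
  by apply: sumr_ge0.
have [|K HK] := @radical_common_exponent X [seq f * g | g <- s] XI.
  by move=> _ /mapP[g /s1[_ [d d1 dg]] ->]; exact: Xf dg.
set s' := [seq f * g | g <- s] in HK *.
set L := (size s' * K).+1.
(* Each induction step splits a generator [g] off [x] and pairs it with one factor [f], lowering
   every [lam j] by at most [N]. After [L] steps there are enough factors [f * g] for the
   pigeonhole. *)
suff H (k : nat) a x w : (size w + k = L)%N -> {subset w <= s'} ->
    (forall j, (k * N)%N%:Z <= lam j a) -> gr a x ->
    X (f ^+ k * x * \prod_(g <- w) g).
  exists L, (L * N)%N => a x ax xa.
  by have := H L a x [::] erefl (fun _ h => False_ind _ (notF h)) ax xa; rewrite big_nil mulr1.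
elim: k a x w => [|k IH] a x w sw ws ka ax.
  case: (XI) => _ _; apply; apply: ideal_prod_count HK _ _ => //.
  by rewrite -[size w]addn0 sw.
apply: (homogeneous_ideal_ind (P := fun x => X (f ^+ k.+1 * x * \prod_(g <- w) g))
    hgr _ (s2 a x _ ax) ax) => [g /s1[_ [d _ dg]]|j|||g d h sg dg hd].
- by exists d.
- by apply: le_trans (ka j); rewrite lez_nat muln_gt0.
- by rewrite mulr0 mul0r; case: XI.
- by move=> y z Xy Xz; rewrite mulrDr mulrDl; case: XI => _ D _; apply: D.
- have -> : f ^+ k.+1 * (h * g) * \prod_(g0 <- w) g0 =
            f ^+ k * h * \prod_(g <- f * g :: w) g.
    by rewrite big_cons exprS; ring.
  apply: IH hd => [|u|j]; first by rewrite -sw /= addSnnS.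
    by rewrite inE => /predU1P[->|/ws //]; exact: map_f.
  have := ka j; have := lamN _ _ j sg dg; rewrite lamB mulSn; lia.
Qed.

End HomogeneousGenerators.

(** * Nonnegative degrees: elements near an axis and the determinant trick *)

Section OrthantGrading.
Variables (n : nat) (A : idomainType) (gr : 'rV[int]_n -> set A).
Hypothesis hgr : is_grading gr.
Hypothesis noeth : noetherian A.
Hypothesis gr1 : gr 0 1.
Hypothesis degree_ge0 :
  forall a x, gr a x -> x != 0 -> forall i, 0 <= a 0 i.
Hypothesis axis_nonzero : forall i : 'I_n,
  exists2 m : int, 0 < m & exists2 y, y != 0 & gr (m *: delta_mx 0 i) y.
Implicit Types (a b d : 'rV[int]_n) (x y f : A) (i j : 'I_n).

Definition axis_ideal i : set A :=
  ideal_gen (\bigcup_(m in [set m : int | 0 < m]) gr (m *: delta_mx 0 i)).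

Definition wt a : int := \sum_j a 0 j.
(** On nonnegative degrees this measures the distance from the [i]-th axis. *)
Definition wt_off i a : int := \sum_(j | j != i) a 0 j.

Lemma wtB a b : wt (a - b) = wt a - wt b.
Proof. by rewrite /wt -sumrB; apply: eq_bigr => j _; rewrite !mxE. Qed.

Lemma wt_offB i a b : wt_off i (a - b) = wt_off i a - wt_off i b.
Proof. by rewrite /wt_off -sumrB; apply: eq_bigr => j _; rewrite !mxE. Qed.

Lemma wt_split i a : wt a = a 0 i + wt_off i a.
Proof. by rewrite /wt (bigD1 i). Qed.

Lemma wt_ge0 a x : gr a x -> x != 0 -> 0 <= wt a.
Proof. by move=> ax x0; apply: sumr_ge0 => j _; exact: degree_ge0 ax x0 j. Qed.

Lemma wt_off_ge0 i a x : gr a x -> x != 0 -> 0 <= wt_off i a.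
Proof. by move=> ax x0; apply: sumr_ge0 => j _; exact: degree_ge0 ax x0 j. Qed.

Lemma wt_gt0 a x : gr a x -> x != 0 -> a != 0 -> 0 < wt a.
Proof.
have aux (u v : int) : ~~ (0 < u + v) -> 0 <= u -> 0 <= v -> u = 0 by lia.
move=> ax x0; apply: contraNT => a0; apply/eqP/rowP => i; rewrite mxE.
rewrite (wt_split i) in a0.
by apply: aux a0 _ _; [exact: degree_ge0 ax x0 i|exact: wt_off_ge0 ax x0].
Qed.

Lemma wt_off_eq0 i a x : gr a x -> x != 0 -> wt_off i a = 0 ->
  a = a 0 i *: delta_mx 0 i.
Proof.
move=> ax x0 /eqP; rewrite psumr_eq0; last by move=> j _; exact: degree_ge0 ax x0 j.
move=> /allP a0; apply/rowP => j; rewrite !mxE eqxx /=.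
have [->|ji] := eqVneq j i; first by rewrite mulr1.
by have := a0 j (mem_index_enum _); rewrite ji /= => /eqP ->; rewrite mulr0.
Qed.

(** [N] bounds the [i]-th coordinate of the generators of the ideal of nonzero degrees. A generator
    on the axis is already in the ideal. Splitting off any other one lowers [wt_off i] by at least 1
    and the [i]-th coordinate by at most [N], so the inequality persists for the cofactor, which has
    smaller weight. *)
Lemma axis_ideal_near_axis i : exists N : nat, forall a x,
  N%:Z * wt_off i a < a 0 i -> gr a x -> axis_ideal i x.
Proof.
have [s [s1 s2]] := homogeneous_generators gr noeth [set a | a != 0].
have [|N N0 HN] := @degree_bound _ _ _ hgr s (fun d => d 0 i).
  by move=> g /s1[g0 [d _ dg]]; split=> //; exists d.
exists N => a x; have [k] := ubnP `|wt a|%N; have XI := ideal_gen_ideal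
  (\bigcup_(m in [set m : int | 0 < m]) gr (m *: delta_mx 0 i)).
elim: k a x => // k IH a x ak aN ax.
have [->|x0] := eqVneq x 0; first by case: XI.
have a0 : a != 0.
  apply: contraTneq aN => ->; rewrite /wt_off big1 ?mulr0 ?mxE // => j _.
  by rewrite mxE.
apply: (homogeneous_ideal_ind (P := axis_ideal i) hgr _ (s2 a x a0 ax) ax).
- by move=> g /s1[_ [d _ dg]]; exists d.
- by case: XI.
- by case: XI.
move=> g d h sg dg hd; have [g0 [d' /= d'0 d'g]] := s1 _ sg.
have {d' d'0 d'g} d0 : d != 0 by rewrite (gr_unique hgr dg d'g g0).
have [->|h0] := eqVneq h 0; first by rewrite mul0r; case: XI.
have wd := wt_gt0 dg g0 d0; have od := wt_off_ge0 i dg g0.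
have [od0|od0] := eqVneq (wt_off i d) 0.
  case: (XI) => _ _; apply; apply: sub_ideal_gen; exists (d 0 i).
    by move: wd; rewrite /= (wt_split i) od0 addr0.
  by rewrite -(wt_off_eq0 dg).
apply: (ideal_mulr _ XI); apply: (IH (a - d) h) => //.
  have := wt_ge0 hd h0; rewrite wtB; lia.
rewrite wt_offB !mxE mulrBr; apply: ltr_leB (aN) _.
apply: le_trans (HN _ _ sg dg) _; rewrite -[leLHS]mulr1 ler_wpM2l //.
by rewrite -gtz0_ge1 lt0r od0.
Qed.

Lemma axis_ideal_radical i b f :
  (forall a x, (forall j, 0 < a 0 j) -> gr a x -> radical (axis_ideal i) x) ->
  0 < b 0 i -> gr b f -> radical (axis_ideal i) f.
Proof.
move=> full bi bf; have XI := ideal_gen_ideal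
  (\bigcup_(m in [set m : int | 0 < m]) gr (m *: delta_mx 0 i)).
have RI := radical_ideal XI.
have [->|f0] := eqVneq f 0; first by case: RI.
have [k [D HD]] : exists k D : nat, forall a x,
    (forall j : {j : 'I_n | j != i}, D%:Z <= a 0 (val j)) -> gr a x ->
    axis_ideal i (f ^+ k * x).
  pose lam (j : {j : 'I_n | j != i}) (a : 'rV[int]_n) : int := a 0 (val j).
  apply: (@radical_high_degrees _ _ _ hgr noeth _ lam (axis_ideal i) f)
    (* Multiplying by an element positive off the [i]-th coordinate gives [f * x] full support. *)
    => [j a c|//|a x a1 ax]; first by rewrite /lam !mxE.
  have [->|x0] := eqVneq x 0; first by rewrite mulr0; case: RI.
  apply: full (grM hgr bf ax) => j; rewrite mxE.
  have [->|ji] := eqVneq j i; first by apply: ltr_wpDr => //; exact: degree_ge0 ax x0 i.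
  by apply: ltr_wpDl; [exact: degree_ge0 bf f0 j|rewrite gtz0_ge1; exact: a1 (Sub j ji)].
pose T := [set a : 'rV[int]_n | forall j : {j : 'I_n | j != i}, D%:Z <= a 0 (val j)].
have [s [s1 s2]] := homogeneous_generators gr noeth T.
suff [l fkl] : radical (axis_ideal i) (f ^+ k) by exists (k * l)%N; rewrite exprM.
apply: (det_trick (s := s)) => //.
(* The ideal of the degrees in [T] is nonzero: it contains the product of the [D]-th powers of
   nonzero axis elements. *)
- have /choice[m Hm] : forall j, exists m : int, 0 < m /\
      exists2 y, y != 0 & gr (m *: delta_mx 0 j) y.
    by move=> j; have [m m0 [y y0 yj]] := axis_nonzero j; exists m; split => //; exists y.
  have /choice[y Hy] : forall j, exists y, y != 0 /\ gr (m j *: delta_mx 0 j) y.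
    by move=> j; case: (Hm j) => _ [y y0 yj]; exists y.
  have : ideal_gen [set` s] (\prod_j y j ^+ D).
    apply: (s2 (\sum_j (m j *: delta_mx 0 j) *+ D)); last first.
      by apply: (gr_prod hgr gr1) => j _; apply: (grX hgr gr1); exact: (Hy j).2.
    move=> [j ji] /=; rewrite summxE (bigD1 j) //= big1 => [|l lj]; last first.
      by rewrite mulmxnE !mxE eqxx eq_sym (negPf lj) /= mulr0 mul0rn.
    rewrite mulmxnE !mxE !eqxx /= mulr1 addr0.
    have := (Hm j).1; rewrite -mulr_natr; nia.
  move=> /ideal_gen_seqP[c ec]; case: s s1 {s2} c ec => [|g s] s1 c.
    rewrite big_ord0 => /eqP; rewrite prodf_seq_eq0 => /hasP[j _] /=.
    by rewrite expf_eq0 (negPf (Hy j).1) andbF.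
  by exists g; [rewrite mem_head|exact: (s1 g (mem_head _ _)).1].
- move=> g sg; have [_ [d Td dg]] := s1 _ sg.
  have cd : gr (b *+ k + d) (f ^+ k * g) by apply: (grM hgr) => //; exact: (grX hgr gr1).
  apply: (homogeneous_ideal_ind (P := fun u => exists c : 'I_(size s) -> A,
    (forall l, axis_ideal i (c l)) /\ u = \sum_(l < size s) c l * s`_l)
    hgr _ (HD d g Td dg) cd).
  + by move=> x [m _ mx]; exists (m *: delta_mx 0 i).
  + exists (fun=> 0); split; first by case: XI.
    by rewrite big1 // => j _; rewrite mul0r.
  + move=> x y [c [Xc ->]] [e [Xe ->]]; exists (fun l => c l + e l); split.
      by move=> j; case: XI => _ XD _; apply: XD; [exact: Xc|exact: Xe].
    by rewrite -big_split; apply: eq_bigr => j _; rewrite mulrDl.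
  + move=> x d' h [m /= m0 mx] d'x hx.
    have Xx : axis_ideal i x by apply: sub_ideal_gen; exists m.
    have [->|x0] := eqVneq x 0.
      exists (fun=> 0); split; first by case: XI.
      by rewrite mulr0 big1 // => j _; rewrite mul0r.
    (* The factor [x] has degree 0 off the [i]-th coordinate, so the cofactor [h] keeps degrees at
       least [D] there. *)
    have /ideal_gen_seqP[c ->] : ideal_gen [set` s] h.
      apply: s2 hx => -[j ji] /=; rewrite (gr_unique hgr d'x mx x0).
      rewrite !mxE mulmxnE (negPf ji) andbF mulr0 subr0.
      have := Td (Sub j ji); have := degree_ge0 bf f0 j; rewrite /= -mulr_natr; nia.
    exists (fun l => c l * x); split=> [l|]; first by case: XI => _ _; apply; exact: Xx.
    by rewrite mulr_suml; apply: eq_bigr => j _; rewrite mulrAC.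
Qed.

End OrthantGrading.

(** * Finiteness over the axis subring *)

Section FiniteSpan.
Variables (A : comNzRingType) (B : set A).
Hypothesis subB : is_subring B.
Implicit Types (s t : seq A) (x y g : A).

(** Has the shape of the condition inside [finite_extension], so that the two are convertible. *)
Definition fin_span s x : Prop := exists c : 'I_(size s) -> A,
  (forall i, B (c i)) /\ x = \sum_(i < size s) c i * s`_i.

Lemma subring1 : B 1.
Proof. by case: subB => + _ _; rewrite inE. Qed.

Lemma subringB x y : B x -> B y -> B (x - y).
Proof. by case: subB => _ h _ Bx By; have := h x y; rewrite !in_setE; apply. Qed.

Lemma subringM x y : B x -> B y -> B (x * y).
Proof. by case: subB => _ _ h Bx By; have := h x y; rewrite !in_setE; apply. Qed.

Lemma subring0 : B 0.
Proof. by rewrite -[0](subrr 1); apply: subringB; exact: subring1. Qed.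

Lemma subringD x y : B x -> B y -> B (x + y).
Proof.
move=> Bx By; rewrite -[y]opprK; apply: subringB => //.
by rewrite -sub0r; apply: subringB => //; exact: subring0.
Qed.

Lemma fin_span0 s : fin_span s 0.
Proof.
exists (fun=> 0); split; first by move=> _; exact: subring0.
by rewrite big1 // => i _; rewrite mul0r.
Qed.

Lemma fin_spanD s x y : fin_span s x -> fin_span s y -> fin_span s (x + y).
Proof.
move=> [c [Bc ->]] [e [Be ->]]; exists (fun i => c i + e i); split.
  by move=> i; exact: subringD.
by rewrite -big_split; apply: eq_bigr => i _; rewrite mulrDl.
Qed.

Lemma fin_spanM s b x : B b -> fin_span s x -> fin_span s (b * x).
Proof.
move=> Bb [c [Bc ->]]; exists (fun i => b * c i); split.
  by move=> i; exact: subringM.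
by rewrite mulr_sumr; apply: eq_bigr => i _; rewrite mulrA.
Qed.

Lemma fin_span_mem s x : x \in s -> fin_span s x.
Proof.
move=> sx; have ls : (index x s < size s)%N by rewrite index_mem.
exists (fun i => if i == Ordinal ls then 1 else 0); split.
  by move=> i; case: ifP => _; [exact: subring1|exact: subring0].
rewrite (bigD1 (Ordinal ls)) //= eqxx nth_index // big1 ?addr0 ?mul1r // => i /negPf ->.
by rewrite mul0r.
Qed.

Lemma fin_span_mull s t g x :
  (forall u, u \in s -> fin_span t (g * u)) -> fin_span s x -> fin_span t (g * x).
Proof.
move=> st [c [Bc ->]]; rewrite mulr_sumr.
apply: big_ind => [|y z|i _]; [exact: fin_span0|exact: fin_spanD|].
by rewrite mulrCA; apply: fin_spanM => //; apply: st; rewrite mem_nth.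
Qed.

End FiniteSpan.

Lemma is_subring_subring_gen (A : comNzRingType) (S : set A) : is_subring (subring_gen S).
Proof.
split=> [|x y|x y]; rewrite !in_setE.
- by move=> J [subJ _]; exact: subring1.
- by move=> Sx Sy J JS; case: (JS) => subJ _; apply: subringB; [|exact: Sx|exact: Sy].
- by move=> Sx Sy J JS; case: (JS) => subJ _; apply: subringM; [|exact: Sx|exact: Sy].
Qed.

Lemma sub_subring_gen (A : comNzRingType) (S : set A) : S `<=` subring_gen S.
Proof. exact: sub_smallest. Qed.

Section AxisFinite.
Variables (n : nat) (A : idomainType) (gr : 'rV[int]_n -> set A).
Hypothesis hgr : is_grading gr.
Hypothesis noeth : noetherian A.
Hypothesis degree_ge0 :
  forall a x, gr a x -> x != 0 -> forall i, 0 <= a 0 i.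
Implicit Types (a b d : 'rV[int]_n) (x y f : A) (i j : 'I_n).

Let B := axis_subring gr.
Let subB : is_subring B. Proof. exact: is_subring_subring_gen. Qed.

Lemma axis_subring_gr0 x : gr 0 x -> axis_subring gr x.
Proof. by move=> x0; apply: sub_subring_gen; left. Qed.

Lemma axis_subring_axis i (m : int) x :
  0 < m -> gr (m *: delta_mx 0 i) x -> axis_subring gr x.
Proof. by move=> m0 xi; apply: sub_subring_gen; right; exists i => //; exists m. Qed.

(** Generators of the ideal of nonzero degrees have positive weight, so their cofactors have smaller
    weight and lie in the previous span. *)
Lemma low_degree_finite (D : nat) : exists s : seq A,
  forall a x, wt a < D%:Z -> gr a x -> fin_span (axis_subring gr) s x.
Proof.
elim: D => [|D [s Hs]].
  exists [::] => a x a0 ax; have [->|x0] := eqVneq x 0; first exact: fin_span0.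
  by have := wt_ge0 degree_ge0 ax x0; move: a0; rewrite ltNge => /negPf ->.
have [t [t1 t2]] := homogeneous_generators gr noeth [set a | a != 0].
(* The entry 1 accounts for degree 0, whose elements belong to the axis subring. *)
exists (1 :: [seq g * u | g <- t, u <- s]) => a x aD ax.
have [a0|a0] := eqVneq a 0.
  rewrite -[x]mulr1; apply: fin_spanM => //; first by apply: axis_subring_gr0; rewrite -a0.
  by apply: fin_span_mem => //; rewrite mem_head.
apply: (homogeneous_ideal_ind (P := fin_span (axis_subring gr) _) hgr _ (t2 a x a0 ax) ax).
- by move=> g /t1[_ [d _ dg]]; exists d.
- exact: fin_span0.
- by move=> y z; exact: fin_spanD.
move=> g d h tg dg hd; have [g0 [d' /= d'0 d'g]] := t1 _ tg.
rewrite (gr_unique hgr d'g dg g0) in d'0.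
have wd := wt_gt0 degree_ge0 dg g0 d'0.
rewrite mulrC; apply: (@fin_span_mull _ _ subB s) => [u su|].
  by apply: fin_span_mem => //; rewrite inE allpairs_f ?orbT.
by apply: Hs hd; rewrite wtB; lia.
Qed.

Lemma finite_extension_axis :
  (forall i b f, 0 < b 0 i -> gr b f -> radical (axis_ideal gr i) f) ->
  finite_extension (axis_subring gr).
Proof.
move=> rad; pose S := \bigcup_(i in [set: 'I_n]) \bigcup_(m in [set m : int | 0 < m])
  gr (m *: delta_mx 0 i).
have QI := ideal_gen_ideal S.
(* With [f = 1] and the weight as only form, all elements of weight at least [D] lie in the ideal of
   the axis elements. *)
have [k [D HD]] : exists k D : nat, forall a x,
    (forall j : unit, D%:Z <= wt a) -> gr a x -> ideal_gen S (1 ^+ k * x).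
  apply: (@radical_high_degrees _ _ _ hgr noeth _ (fun=> @wt n)) => [_ a b|//|a x a1 ax].
    exact: wtB.
  rewrite mul1r; have [->|x0] := eqVneq x 0; first by case: (radical_ideal QI).
  have [i ai] : exists i, 0 < a 0 i.
    apply: contrapT => /forallNP a0; have := a1 tt; rewrite leNgt => /negP; apply.
    have : wt a <= 0 by apply: sumr_le0 => i _; rewrite leNgt; apply/negP.
    by move/le_lt_trans; apply.
  have [l xl] := rad i a x ai ax; exists l; apply: ideal_gen_min xl => // y [m m0 my].
  by apply: sub_ideal_gen; exists i => //; exists m.
have [s Hs] := low_degree_finite D.
exists s => x; change (fin_span B s x).
elim/(homogeneous_ind hgr): x => [|x y|a x].
- exact: fin_span0.
- exact: fin_spanD.
(* Graded Nakayama: from weight [D] on, axis elements of positive weight are split off, and their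
   cofactors have smaller weight. *)
have [l] := ubnP `|wt a|%N; elim: l a x => // l IH a x al ax.
have [aD|Da] := ltP (wt a) D%:Z; first exact: Hs ax.
have := HD a x (fun=> Da) ax; rewrite expr1n mul1r => Sx.
apply: (homogeneous_ideal_ind (P := fin_span B s) hgr _ Sx ax).
- by move=> y [i _ [m _ yi]]; exists (m *: delta_mx 0 i).
- exact: fin_span0.
- by move=> y z; exact: fin_spanD.
move=> y d h [i _ [m /= m0 yi]] dy hd; rewrite mulrC.
have [->|y0] := eqVneq y 0; first by rewrite mul0r; exact: fin_span0.
have [->|h0] := eqVneq h 0; first by rewrite mulr0; exact: fin_span0.
apply: fin_spanM => //; first exact: axis_subring_axis yi.
have wh := wt_ge0 degree_ge0 hd h0; apply: IH hd.
have : 0 < wt d.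
  apply: (wt_gt0 degree_ge0 dy y0); apply: contraTneq m0 => d0.
  have /rowP/(_ i) := gr_unique hgr yi dy y0.
  by rewrite d0 !mxE !eqxx /= mulr1 => ->.
move: wh; rewrite wtB; lia.
Qed.

End AxisFinite.

(** * Consequences of the degree cone being the orthant *)

Section DegreeCone.
Variables (R : realType) (n : nat).
Implicit Types (i j : 'I_n).

Lemma positive_lower_bound (f : 'I_n -> R) : (forall i, 0 < f i) ->
  exists2 e : R, 0 < e & forall i, e <= f i.
Proof.
move=> f0; exists (\big[Num.min/1]_i f i).
  by apply: (big_ind (fun x => 0 < x)) => // x y x0 y0; rewrite lt_min x0.
by move=> i; exact: bigmin_le.
Qed.

Lemma relint_orthant (x : 'rV[R]_n) :
  (forall i, 0 < x 0 i) -> relint (orthant R n) x.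
Proof.
move=> x0; have [e e0 ex] := positive_lower_bound x0; split=> [i|]; first exact: ltW.
suff : nbhs x (orthant R n) by apply: filterS.
apply/nbhs_ballP; exists e => //= y xy i.
have [_ /(_ 0 i) xyi] := xy; have := ex i; move: xyi; rewrite /ball /=.
by move=> /(le_lt_trans (ler_norm _)); lra.
Qed.

Variables (A : idomainType) (gr : 'rV[int]_n -> set A).
Hypothesis hgr : is_grading gr.
Hypothesis hC : degree_cone R gr = orthant R n.

Lemma degree_ge0 (a : 'rV[int]_n) x : gr a x -> x != 0 -> forall i, 0 <= a 0 i.
Proof.
move=> ax x0 i; have : orthant R n (intv R a).
  rewrite -hC; exists [:: (1, a)]; split.
    move=> p; rewrite inE => /eqP -> /=; split=> // gra.
    by move: ax; rewrite gra => /= /eqP; rewrite (negPf x0).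
  by rewrite big_cons big_nil addr0 scale1r.
by move=> /(_ i); rewrite mxE ler0z.
Qed.

(** The [i]-th unit vector is a nonnegative combination of degrees. Since all degrees are
    nonnegative, those with a nonzero coefficient vanish off [i], and one of them must be nonzero at
    [i]. *)
Lemma axis_nonzero i :
  exists2 m : int, 0 < m & exists2 y, y != 0 & gr (m *: delta_mx 0 i) y.
Proof.
have : orthant R n (delta_mx 0 i) by move=> j; rewrite mxE ler0n.
rewrite -hC => -[l [lC el]].
have lge0 p j : p \in l -> 0 <= p.1 * (p.2 0 j)%:~R.
  move=> lp; have [p0 gp] := lC p lp; apply: mulr_ge0 => //; rewrite ler0z.
  have [y [gy y0]] : exists y, gr p.2 y /\ y != 0.
    apply: contrapT => /forallNP H; apply: gp; apply/seteqP; split=> y /=.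
      by move=> gy; apply: contrapT => /eqP y0; exact: (H y).
    by move=> ->; exact: gr0.
  exact: degree_ge0 gy y0 j.
have coord j : (i == j)%:R = \sum_(p <- l) p.1 * (p.2 0 j)%:~R.
  have := congr1 (fun v : 'rV[R]_n => v 0 j) el.
  rewrite mxE eqxx /= eq_sym summxE => ->.
  by apply: eq_bigr => p _; rewrite !mxE.
have /hasP[p lp pi] : has (fun p : R * 'rV[int]_n => p.1 * (p.2 0 i)%:~R != 0) l.
  apply: contraT => /hasPn H; have := coord i; rewrite eqxx big_seq big1 => [/eqP|q /H].
    by rewrite oner_eq0.
  by rewrite negbK => /eqP.
have [p1 gp] := lC p lp.
have p1_neq0 : p.1 != 0 by apply: contraNneq pi => ->; rewrite mul0r.
have pj j : j != i -> p.2 0 j = 0.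
  move=> ji; have := coord j; rewrite eq_sym (negPf ji) => /esym/eqP.
  rewrite big_seq psumr_eq0; last by move=> q lq; exact: lge0.
  move=> /allP/(_ _ lp); rewrite lp /= mulf_eq0 (negPf p1_neq0) intr_eq0.
  by move/eqP.
have pE : p.2 = p.2 0 i *: delta_mx 0 i.
  apply/rowP => j; rewrite !mxE eqxx /=; have [->|/pj ->] := eqVneq j i.
    by rewrite mulr1.
  by rewrite mulr0.
exists (p.2 0 i).
  have := lge0 p i lp; rewrite le0r (negPf pi) /= pmulr_rgt0 ?ltr0z //.
  by rewrite lt0r p1_neq0.
apply: contrapT => H; apply: gp; apply/seteqP; split=> y /=.
  by rewrite pE => gy; apply: contrapT => /eqP y0; apply: H; exists y.
by move=> ->; exact: gr0.
Qed.

Hypothesis noeth : noetherian A.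

(** The radical ray ideal in the direction of [a] equals the one in a direction [b'] close to the
    [i]-th axis, whose ray ideal is contained in the axis ideal. *)
Lemma full_support_axis_radical i (a : 'rV[int]_n) x :
  is_ray_ideal_cone gr (degree_cone R gr) ->
  (forall j, 0 < a 0 j) -> gr a x -> radical (axis_ideal gr i) x.
Proof.
rewrite hC => -[_ _ rayJ] a0 ax.
have [N HN] := axis_ideal_near_axis hgr noeth degree_ge0 i.
pose a' : 'rV[rat]_n := map_mx intr a.
(* The [i]-th entry exceeds [N] times the sum of the others by 1, so every degree on this ray
   satisfies the strict inequality of [HN]. *)
pose b' : 'rV[rat]_n := \row_j if j == i then N%:R * (\sum_(k | k != i) 1) + 1 else 1.
have pa' : relint (orthant R n) (ratv R a').
  by apply: relint_orthant => j; rewrite !mxE ratr_int ltr0z.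
have pb' : relint (orthant R n) (ratv R b').
  apply: relint_orthant => j; rewrite !mxE ltr0q; case: ifP => // _.
  by rewrite ltr_wpDl // mulr_ge0 // sumr_ge0.
have [Jab _] := rayJ a' b' pa' pb'.
have : rad_ray_ideal R gr a' x.
  apply: sub_radical; apply: sub_ideal_gen; exists a => //; exists 1 => //.
  by rewrite scale1r; apply/rowP => j; rewrite !mxE ratr_int.
rewrite Jab => -[k xk]; exists k; apply: ideal_gen_min xk; first exact: ideal_gen_ideal.
move=> y [c [r r0 cr] cy]; apply: HN cy.
have cE j : (c 0 j)%:~R = r * ratr (b' 0 j) by have /rowP/(_ j) := cr; rewrite !mxE.
rewrite -(ltr_int R) intrM cE !mxE eqxx /wt_off rmorph_sum /=.
under eq_bigr => j /negPf ji do rewrite cE mxE ji rmorph1 mulr1.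
rewrite rmorphD rmorphM rmorph1 rmorph_sum /= ratr_nat.
under [in ltRHS]eq_bigr do rewrite rmorph1.
rewrite (eq_bigr (fun=> r * 1)) => [|j _]; last by rewrite mulr1.
by rewrite -mulr_sumr; move: (\sum_(j | j != i) 1) => s; nra.
Qed.

End DegreeCone.

(** * Faces of the orthant and the converse *)

Section OrthantFaces.
Variables (R : realType) (n : nat).
Implicit Types (S : pred 'I_n) (x y z : 'rV[R]_n) (i j : 'I_n).

Definition coord_face S : set 'rV[R]_n :=
  [set x | orthant R n x /\ forall i, ~~ S i -> x 0 i = 0].

(** A form that is nonnegative on the orthant is nonnegative on unit vectors, so it vanishes at [x]
    exactly when each of its terms does. [S] collects the unit vectors it kills. *)
Lemma is_face_orthant t : is_face (orthant R n) t -> exists S, t = coord_face S.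
Proof.
case=> u [u0 ->]; exists (fun i => u (delta_mx 0 i) == 0).
have ue i : 0 <= u (delta_mx 0 i) by apply: u0 => j; rewrite mxE ler0n.
have uE x : u x = \sum_i x 0 i * u (delta_mx 0 i).
  by rewrite {1}(row_sum_delta x) linear_sum; apply: eq_bigr => i _; rewrite linearZ.
apply/seteqP; split=> x [x0 xu]; split=> //.
  move=> i ui; move/eqP: xu; rewrite uE psumr_eq0.
    by move=> /allP/(_ i (mem_index_enum _)); rewrite /= mulf_eq0 (negPf ui) orbF => /eqP.
  by move=> j _; apply: mulr_ge0; [exact: x0|].
rewrite uE big1 // => i _; have [->|/xu ->] := eqVneq (u (delta_mx 0 i)) 0.
  by rewrite mulr0.
by rewrite mul0r.
Qed.

Lemma is_cone_coord_face S : is_cone (coord_face S).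
Proof.
split=> [x y [x0 xS] [y0 yS]|x r r0 [x0 xS]]; split=> i.
- by rewrite mxE addr_ge0.
- by move=> Si; rewrite mxE xS // yS // addr0.
- by rewrite mxE mulr_ge0.
- by move=> Si; rewrite mxE xS // mulr0.
Qed.

Lemma diffset_coord_faceP S z :
  diffset (coord_face S) z <-> forall i, ~~ S i -> z 0 i = 0.
Proof.
split=> [[x [y [[_ xS] [_ yS] ->]]] i Si|zS].
  by rewrite !mxE xS // yS // subr0.
(* Positive and negative parts of [z]. *)
exists (\row_i Num.max (z 0 i) 0), (\row_i Num.max (- z 0 i) 0); split.
- split=> i; first by rewrite mxE le_max lexx orbT.
  by move=> Si; rewrite mxE zS // maxxx.
- split=> i; first by rewrite mxE le_max lexx orbT.
  by move=> Si; rewrite mxE zS // oppr0 maxxx.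
- apply/rowP => i; rewrite !mxE; have [z0|/ltW z0] := leP 0 (z 0 i).
    by rewrite (max_idPr _) ?oppr_le0 // subr0.
  by rewrite (max_idPl _) ?oppr_ge0 // sub0r opprK.
Qed.

Lemma rational_span_coord_face S : rational_span (diffset (coord_face S)).
Proof.
exists [seq delta_mx 0 i | i <- enum S]; apply/seteqP; split=> z; last first.
  rewrite diffset_coord_faceP /=; set X := map _ _ => /(@coord_span _ _ _ (in_tuple X)) -> i Si.
  rewrite summxE big1 // => k _; rewrite mxE.
  have /mapP[_ /mapP[j + ->] ->] := mem_nth 0 (ltn_ord k).
  rewrite mem_enum !mxE eqxx /= => Sj; case: eqP => [ij|_]; first by case/negP: Si; rewrite ij.
  by rewrite rmorph0 mulr0.
move=> /diffset_coord_faceP zS /=; rewrite (row_sum_delta z).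
apply: memv_suml => i _; have [Si|/zS ->] := boolP (S i); last by rewrite scale0r mem0v.
apply: memvZ; apply: memv_span; apply/mapP; exists (delta_mx 0 i).
  by apply: map_f; rewrite mem_enum.
by apply/rowP => j; rewrite !mxE rmorph_nat.
Qed.

(** If [x 0 i = 0] for some [i] in [S], a small move against the [i]-th unit vector stays in the
    span of the face but leaves the orthant. *)
Lemma relint_coord_face S x : relint (coord_face S) x ->
  (forall i, S i -> 0 < x 0 i) /\ (forall i, ~~ S i -> x 0 i = 0).
Proof.
case=> -[x0 xS] xnb; split=> // i Si; rewrite lt0r x0 andbT.
apply/negP => /eqP xi; have /nbhs_ballP[e /= e0 H] := xnb.
have [/(_ i) + _] : coord_face S (x - (e / 2) *: delta_mx 0 i).
  apply: H => /=.
    split=> // k j; rewrite /ball /= !mxE ord1 eqxx /= opprB addrC subrK.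
    case: (j == i); rewrite ?mulr1 ?mulr0 ?normr0 // gtr0_norm; lra.
  apply/diffset_coord_faceP => j Sj; rewrite !mxE eqxx /= xS //.
  by case: eqP => [ji|_]; [by case/negP: Sj; rewrite ji|rewrite mulr0 subr0].
by rewrite !mxE !eqxx xi /=; lra.
Qed.

End OrthantFaces.

(** * Homogeneous components of elements of the axis subring *)

Section AdditiveSpan.
Variable A : comNzRingType.
Implicit Types (S : set A) (x y : A).

Definition is_additive S : Prop := S 0 /\ forall x y, S x -> S y -> S (x + y).

(** For axis products, signs are absorbed by the factor of degree 0, so closure under sums is
    enough. *)
Definition add_span S : set A := smallest is_additive S.

Lemma sub_add_span S : S `<=` add_span S.
Proof. exact: sub_smallest. Qed.

Lemma is_additive_add_span S : is_additive (add_span S).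
Proof.
split=> [J [[]//]|x y Sx Sy J JS]; case: (JS) => -[J0 JD] _.
by apply: JD; [exact: Sx|exact: Sy].
Qed.

Lemma add_span_mul (S S' S'' : set A) :
  (forall x y, S x -> S' y -> S'' (x * y)) ->
  forall x y, add_span S x -> add_span S' y -> add_span S'' (x * y).
Proof.
move=> SS x y Sx S'y; have [add0 addD] := is_additive_add_span S''.
have : add_span S `<=` [set x | add_span S'' (x * y)].
  apply: smallest_sub => [|{Sx}x Sx].
    by split=> [|z w] /=; rewrite ?mul0r ?mulrDl //; exact: addD.
  have : add_span S' `<=` [set y | add_span S'' (x * y)].
    apply: smallest_sub => [|z Sz]; last exact: (sub_add_span (SS _ _ Sx Sz)).
    by split=> [|z w] /=; rewrite ?mulr0 ?mulrDr //; exact: addD.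
  exact.
exact.
Qed.

End AdditiveSpan.

Section AxisParts.
Variables (n : nat) (A : comNzRingType) (gr : 'rV[int]_n -> set A).
Hypothesis hgr : is_grading gr.
Hypothesis gr1 : gr 0 1.
Implicit Types (d e : 'rV[int]_n) (x u : A) (i j : 'I_n).

Definition axis_products d : set A := [set x | exists u (y : 'I_n -> A),
  [/\ gr 0 u, forall i, gr (d 0 i *: delta_mx 0 i) (y i) & x = u * \prod_i y i]].

Lemma axis_products_mul d e x z :
  axis_products d x -> axis_products e z -> axis_products (d + e) (x * z).
Proof.
move=> [u [y [u0 yd ->]]] [v [w [v0 we ->]]]; exists (u * v), (fun i => y i * w i).
split=> [|i|]; first by rewrite -[0]addr0; exact: grM.
- by rewrite mxE scalerDl; exact: grM.
- by rewrite big_split /= mulrACA.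
Qed.

(** The elements all of whose components are sums of axis products form a subring containing the
    generators of the axis subring. *)
Lemma axis_subring_hcomp x d :
  axis_subring gr x -> add_span (axis_products d) (hcomp hgr d x).
Proof.
pose T := [set x | forall d, add_span (axis_products d) (hcomp hgr d x)].
have addS e := is_additive_add_span (axis_products e).
have mulS a e y z : add_span (axis_products a) y ->
    add_span (axis_products e) z -> add_span (axis_products (a + e)) (y * z).
  by apply: add_span_mul => u v; exact: axis_products_mul.
have T_hom e y : gr e y -> add_span (axis_products e) y -> T y.
  move=> ye Ty d'; rewrite (hcomp_hom hgr d' ye); case: eqP => [->//|_].
  by case: (addS d').
have T_subring : is_subring T.
  split=> [|y z|y z]; rewrite !in_setE.
  - apply: (T_hom 0 1) => //; apply: sub_add_span; exists 1, (fun=> 1).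
    by split=> // [i|]; rewrite ?mxE ?scale0r // big1 // mulr1.
  - move=> Ty Tz e; rewrite hcompD hcompN; apply: (addS e).2; first exact: Ty.
    rewrite -mulN1r -[e in add_span (_ e)]add0r; apply: mulS; last exact: Tz.
    apply: sub_add_span; exists (-1), (fun=> 1).
    by split=> [|i|]; rewrite ?mxE ?scale0r // ?big1 ?mulr1 //; exact: grN.
  - move=> Ty Tz e; have [_ _ ->] := hcompP hgr y; rewrite mulr_suml hcomp_sum.
    apply: big_ind => [||a _]; [exact: (addS e).1|exact: (addS e).2|].
    rewrite (hcompM hgr _ _ (gr_hcomp hgr a y)) -[e in add_span (_ e)](subrKC a).
    by apply: mulS; [exact: Ty|exact: Tz].
suff : axis_subring gr `<=` T by move=> /(_ x) /[apply]; exact.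
apply: smallest_sub => // y [y0|[i _ [m _ yi]]].
  apply: (T_hom 0) => //; apply: sub_add_span; exists y, (fun=> 1).
  by split=> // [i|]; rewrite ?mxE ?scale0r // big1 // mulr1.
apply: (T_hom (m *: delta_mx 0 i)) => //; apply: sub_add_span.
exists 1, (fun j => if j == i then y else 1); split=> // [j|].
  rewrite !mxE eqxx /=; case: eqP => [->|_]; first by rewrite mulr1.
  by rewrite mulr0 scale0r.
by rewrite mul1r -big_mkcond big_pred1_eq.
Qed.

End AxisParts.

(** * From finiteness to equality of the radical ray ideals on a face *)

Section FiniteImpliesRay.
Variables (R : realType) (n : nat) (A : idomainType) (gr : 'rV[int]_n -> set A).
Hypothesis hgr : is_grading gr.
Hypothesis gr1 : gr 0 1.
Implicit Types (S : pred 'I_n) (a b : 'rV[rat]_n) (d : 'rV[int]_n) (i j : 'I_n).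

(** Describes the rational points of the relative interior of [coord_face S]. *)
Definition pos_support S a :=
  (forall i, S i -> 0 < a 0 i) /\ (forall i, ~~ S i -> a 0 i = 0).

Lemma integer_multiple S a : pos_support S a -> exists2 M : nat, (0 < M)%N &
  exists alpha : 'I_n -> nat, (forall i, (alpha i)%:R = M%:R * a 0 i) /\
    forall i, ~~ S i -> alpha i = 0%N.
Proof.
case=> aS a0; pose q i := `|denq (a 0%R i)|%N.
(* Denominators are cleared by their product. *)
exists (\prod_i q i)%N; first by apply: prodn_gt0 => i; rewrite absz_gt0 denq_neq0.
exists (fun i => `|numq (a 0%R i)| * \prod_(j | j != i) q j)%N; split=> [i|i /a0 ->].
  have ai : 0 <= a 0 i by have [/aS/ltW|/a0 ->] := boolP (S i).
  have numE : (`|numq (a 0%R i)|%N)%:R = (numq (a 0 i))%:~R :> rat.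
    by rewrite pmulrn abszE ger0_norm ?numq_ge0.
  have denE : (q i)%:R = (denq (a 0 i))%:~R :> rat.
    by rewrite pmulrn abszE gtr0_norm ?denq_gt0.
  rewrite [in RHS](bigD1 i) //= !natrM numE denE; set Q := (\prod_(j | j != i) q j)%:R.
  by rewrite -{3}(divq_num_den (a 0 i)) mulrAC; congr (_ * _);
    rewrite [RHS]mulrC mulfVK ?intr_eq0 ?denq_neq0.
by have /eqP -> : numq (0 : rat) == 0 by rewrite numq_eq0.
Qed.

(** The exponents [N i] balance the degrees: [y i ^+ N i] has degree [P * alpha i] on axis [i], so
    the product has degree [P * M] times [a]. Off [S] both [alpha i] and [N i] are 0. *)
Lemma prod_axis_rad_ray_ideal S a d (y : 'I_n -> A) : pos_support S a ->
  (forall i, S i -> 0 < d 0 i) -> (forall i, gr (d 0 i *: delta_mx 0 i) (y i)) ->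
  rad_ray_ideal R gr a (\prod_i y i).
Proof.
move=> aS dS yd; have [M M0 [alpha [alphaE alpha0]]] := integer_multiple aS.
pose q i := if S i then `|d 0%R i|%N else 1%N.
have q0 i : (0 < q i)%N by rewrite /q; case: ifP => // /dS; lia.
pose N i := (alpha i * \prod_(j | j != i) q j)%N.
pose P := (\prod_i q i)%N.
have P0 : (0 < P)%N by apply: prodn_gt0.
have dN i : d 0 i *+ N i = (P * alpha i)%N%:Z.
  rewrite /N /P; have [Si|/alpha0 ->] := boolP (S i); last by rewrite muln0 mul0n mulr0n.
  rewrite [in RHS](bigD1 i) //= {2}/q Si -mulr_natr natz.
  move: (dS i Si) (\prod_(j | j != i) q j)%N (alpha i) => di p l.
  by rewrite -[X in X * _](gtz0_abs di) -PoszM; congr Posz; lia.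
(* A single exponent dominating every [N i]; the excess powers act as a multiplier. *)
exists (\sum_i N i)%N; rewrite -prodrXl.
have -> : \prod_i y i ^+ (\sum_i N i)%N =
    (\prod_i y i ^+ (\sum_i N i - N i)%N) * \prod_i y i ^+ N i.
  rewrite -big_split /=; apply: eq_bigr => i _; rewrite -exprD subnK //.
  by rewrite (bigD1 i) //= leq_addr.
case: (ideal_gen_ideal (\bigcup_(b in [set b | exists2 r : R, 0 < r &
  intv R b = r *: ratv R a]) gr b)) => _ _; apply; apply: sub_ideal_gen.
exists (\sum_i (d 0 i *: delta_mx 0 i) *+ N i); last first.
  by apply: (gr_prod hgr gr1) => i _; exact: (grX hgr gr1).
exists (P * M)%:R; first by rewrite ltr0n muln_gt0 P0.
apply/rowP => j; rewrite !mxE summxE (bigD1 j) //= big1 => [|i ij].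
  rewrite mulmxnE !mxE !eqxx /= mulr1 addr0 dN -pmulrn natrM -mulrA natrM.
  by congr (_ * _); rewrite -(ratr_nat R) alphaE rmorphM /= ratr_nat.
by rewrite mulmxnE !mxE eqxx eq_sym (negPf ij) mulr0 mul0rn.
Qed.

Lemma axis_span_rad_ray_ideal S a d x : pos_support S a ->
  (forall i, S i -> 0 < d 0 i) -> add_span (axis_products gr d) x ->
  rad_ray_ideal R gr a x.
Proof.
move=> aS dS; have JI := radical_ideal (ideal_gen_ideal
  (\bigcup_(b in [set b | exists2 r : R, 0 < r & intv R b = r *: ratv R a]) gr b)).
suff /(_ x) : add_span (axis_products gr d) `<=` rad_ray_ideal R gr a by [].
apply: smallest_sub => [|_ [u [y [_ yd ->]]]]; first by case: JI.
by case: JI => _ _; apply; exact: (prod_axis_rad_ray_ideal aS dS yd).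
Qed.

Lemma rad_ray_ideal_neq0 S a : pos_support S a ->
  (forall i, exists2 m : int, 0 < m & exists2 y, y != 0 & gr (m *: delta_mx 0 i) y) ->
  rad_ray_ideal R gr a <> [set 0].
Proof.
move=> aS axis J0.
have /choice[m Hm] : forall i, exists m : int, (S i -> 0 < m) /\
    exists2 y, y != 0 & gr (m *: delta_mx 0 i) y.
  by move=> i; have [m m0 Hy] := axis i; exists m.
have /choice[y Hy] : forall i, exists y, y != 0 /\ gr (m i *: delta_mx 0 i) y.
  by move=> i; case: (Hm i) => _ [y y0 yi]; exists y.
have : rad_ray_ideal R gr a (\prod_i y i).
  apply: (@prod_axis_rad_ray_ideal S a (\row_i m i)) => // i; rewrite mxE.
    exact: (Hm i).1.
  exact: (Hy i).2.
rewrite J0 /= => /eqP; rewrite prodf_seq_eq0 => /hasP[i _] /=.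
by rewrite (negPf (Hy i).1).
Qed.

(** As [J] is radical, it suffices that some power of each homogeneous generator [f] of the ray
    ideal of [b] lies in [J]. That power is expanded in the module generators and its component of
    degree [c *+ N] is taken. *)
Lemma finite_rad_ray_ideal_sub S a b : finite_extension (axis_subring gr) ->
  pos_support S a -> pos_support S b ->
  rad_ray_ideal R gr b `<=` rad_ray_ideal R gr a.
Proof.
move=> [s Hs] aS bS; set J := rad_ray_ideal R gr a.
have JI : is_ideal J by apply: radical_ideal; exact: ideal_gen_ideal.
move=> x [l xl]; apply: radical_idem; exists l.
apply: ideal_gen_min xl => // f [c [r r0 cr] cf].
have cS i : S i -> 0 < c 0 i.
  move=> Si; have /rowP/(_ i) := cr; rewrite !mxE => e.
  by rewrite -(ltr0z R) e mulr_gt0 // ltr0q; exact: bS.1.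
(* In degree [k c] with [k] large, the coefficients of an element of the
   finite module [A] have degrees positive on [S]. *)
have [N HN] : exists N : nat, forall k g y, (N <= k)%N -> g \in s ->
    axis_subring gr y -> J (hcomp hgr (c *+ k) (y * g)).
  elim: s {Hs} => [|g s [N IH]]; first by exists 0%N.
  suff [N' HN'] : exists N : nat, forall k y, (N <= k)%N ->
      axis_subring gr y -> J (hcomp hgr (c *+ k) (y * g)).
    exists (N + N')%N => k h y Nk; rewrite inE => /predU1P[->|hs].
      by apply: HN'; apply: leq_trans Nk; rewrite leq_addl.
    by apply: IH => //; apply: leq_trans Nk; rewrite leq_addr.
  elim/(homogeneous_ind hgr): g => [|g h [N1 H1] [N2 H2]|d g dg].
  - by exists 0%N => k y _ _; rewrite mulr0 hcomp0; case: JI.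
  - exists (N1 + N2)%N => k y Nk By; rewrite mulrDr hcompD.
    case: JI => _ JD _; apply: JD.
      by apply: H1 => //; apply: leq_trans Nk; rewrite leq_addr.
    by apply: H2 => //; apply: leq_trans Nk; rewrite leq_addl.
  (* Since [c 0 i] is at least 1 on [S], this bound makes [c *+ k - d] positive on [S]. *)
  exists (\sum_i `|d 0%R i|).+1%N => k y Nk By; rewrite mulrC (hcompM hgr _ _ dg).
  case: (JI) => _ _; apply.
  apply: (axis_span_rad_ray_ideal aS _ (axis_subring_hcomp hgr gr1 By)) => i Si.
  rewrite mxE mulmxnE mxE subr_gt0 -mulr_natr natz; apply: (@lt_le_trans _ _ k%:Z).
    apply: le_lt_trans (lez_abs _) _; rewrite ltz_nat; apply: leq_ltn_trans Nk.
    by rewrite (bigD1 i) //= leq_addr.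
  by rewrite -[leLHS]mul1r ler_wpM2r // -gtz0_ge1 cS.
apply: radical_idem; exists N.
rewrite -(hcomp_self hgr (grX hgr gr1 N cf)); have [e [Be ->]] := Hs (f ^+ N).
rewrite hcomp_sum; apply: ideal_sum => // i _.
by apply: HN => //; rewrite mem_nth.
Qed.

End FiniteImpliesRay.

Theorem theorem4p1 (R : realType) (n : nat) (A : idomainType)
    (gr : 'rV[int]_n -> set A)
    (hgr : is_grading gr)
    (hnoeth : noetherian A)
    (hA0 : is_subfield (gr 0))
    (hC : degree_cone R gr = orthant R n) :
  [<-> finite_extension (axis_subring gr);
       forall t : set 'rV[R]_n, is_face (orthant R n) t ->
         is_ray_ideal_cone gr t;
       is_ray_ideal_cone gr (degree_cone R gr)].
Proof.
have gr1 : gr 0 1 by apply: subring1; exact: hA0.1.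
have deg_ge0 := degree_ge0 hC; have axis := axis_nonzero hgr hC.
tfae.
- move=> fin t /is_face_orthant[S ->]; split.
  + exact: is_cone_coord_face.
  + exact: rational_span_coord_face.
  have pos a : relint (coord_face S) (ratv R a) -> pos_support S a.
    move=> /relint_coord_face[aS a0]; split=> i Si.
      by have := aS i Si; rewrite mxE ltr0q.
    by have /eqP := a0 i Si; rewrite mxE fmorph_eq0 => /eqP.
  move=> a b /pos aS /pos bS; split.
    apply/seteqP; split; first exact: (finite_rad_ray_ideal_sub hgr gr1 fin bS aS).
    exact: (finite_rad_ray_ideal_sub hgr gr1 fin aS bS).
  exact: (rad_ray_ideal_neq0 hgr gr1 bS axis).
- move=> faces; rewrite hC; apply: faces.
  (* The zero form cuts out the whole orthant. *)
  exists \0; split=> [x _ //|]; apply/seteqP; split=> [x x0|x []] //.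
- move=> ray; apply: (finite_extension_axis hgr hnoeth deg_ge0) => i b f.
  apply: (axis_ideal_radical hgr hnoeth gr1 deg_ge0 axis) => a x a0 ax.
  exact: (full_support_axis_radical hgr hC hnoeth i ray a0 ax).
Qed.
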